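(* Let $p\geqslant 19$ be a prime number with $p\equiv -1\bmod 5$, let $t_1,t_2\in\{1,\ldots,p-1\}$ be the two solutions of $y^2+y-1\equiv 0\bmod p$, and let $$\hat{\mathbf{G}}_0=\langle a,b,c,d : a^p=b^p=c^5=d^2=[a,b]=(da)^2=(db)^2=1,\ cac^{-1}=b^{t_2},\ cbc^{-1}=(ab)^{t_1},\ dcd=a^{t_1^2}b^2c\rangle .$$ Up to duality, there are precisely two orientably-regular maps of Euler characteristic $-2p^2$ of type $\{5,10\}$ with orientation-preserving automorphism group isomorphic to $\hat{\mathbf{G}}_0$. They are reflexive.
   Context: A map $\mathscr{M}$ on a compact connected oriented surface $X$ is an embedding in $X$ of a finite connected graph whose complement is a disjoint union of topological discs, called faces. The Euler characteristic of the map is that of $X$. An automorphism of $\mathscr{M}$ is an incidence-preserving permutation of its edges, vertices and faces induced by a homeomorphism of $X$; $\mathrm{Aut}^+(\mathscr{M})$ is the group of those induced by orientation-preserving homeomorphisms. The map is orientably-regular if $\mathrm{Aut}^+(\mathscr{M})$ acts regularly on the set of arcs (edges endowed with a direction). Its type is $\{m,k\}$, where $k$ is the degree of each vertex and $m$ the size of each face. Equivalently, isomorphism classes of orientably-regular maps of type $\{m,k\}$ correspond to the finite index torsion-free normal subgroups $\Gamma$ of the triangle group $\Delta(2,m,k)=\langle y_1,y_2,y_3 : y_1^2=y_2^m=y_3^k=y_1y_2y_3=1\rangle$, with $\mathrm{Aut}^+(\mathscr{M})\cong\Delta(2,m,k)/\Gamma$. The dual map interchanges the roles of vertices and faces. An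 orientably-regular map is reflexive if it admits an orientation-reversing automorphism. Maps are counted up to orientation-preserving isomorphism. *)

(* Defs.v *)
From HB Require Import structures.
From mathcomp Require Import all_boot all_order all_fingroup all_algebra.
Set Implicit Arguments.
Unset Strict Implicit.
Unset Printing Implicit Defensive.

Import GroupScope.

(* A map on a compact connected oriented surface, given by its rotation system.
   [rev] reverses an arc; [rot] sends an arc to the next one, in the positive
   sense, around its initial vertex.  Transitivity (connectedness of the graph)
   includes non-emptiness: the one-vertex map without edges on the sphere, whose
   rotation system is empty, is left out. *)
Record oriented_map := OrientedMap {
  arc :> finType;
  rot : {perm arc};
  rev : {perm arc};
  rev_neq : forall x, rev x != x;
  rev_rev : forall x, rev (rev x) = x;
  map_connected : [transitive <<[set rot; rev]>>, on [set: arc] | 'P]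
}.

(* [nextf x] is rot^-1 (rev x), permutations being multiplied left to right: the
   next arc on the boundary of the face to the left of [x]. *)
Definition nextf (M : oriented_map) : {perm M} := rev M * (rot M)^-1.

Definition vertices (M : oriented_map) : {set {set M}} := porbits (rot M).
Definition edges (M : oriented_map) : {set {set M}} := porbits (rev M).
Definition faces (M : oriented_map) : {set {set M}} := porbits (nextf M).

Definition euler_char (M : oriented_map) : int :=
  (#|vertices M|%:Z - #|edges M|%:Z + #|faces M|%:Z)%R.

(* Type {m, k}; an edge with the same face on both sides, or a loop, counts
   twice in the size of the face, resp. in the degree of the vertex. *)
Definition has_type (M : oriented_map) (m k : nat) : Prop :=
  (forall f, f \in faces M -> #|f| = m) /\
  (forall v, v \in vertices M -> #|v| = k).

Definition map_iso (M N : oriented_map) : Prop :=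
  exists f : M -> N, [/\ bijective f,
    forall x, f (rot M x) = rot N (f x) & forall x, f (rev M x) = rev N (f x)].

(* The centraliser in {perm M}, i.e. the permutations of the arcs commuting with
   both [rot M] and [rev M]. *)
Definition Aut_plus (M : oriented_map) : {group {perm M}} :=
  'C([set rot M; rev M])%G.

Definition orientably_regular (M : oriented_map) : Prop :=
  [transitive Aut_plus M, on [set: M] | 'P] /\
  forall x : M, 'C_(Aut_plus M)[x | 'P] = 1.

Definition reflexive_map (M : oriented_map) : Prop :=
  exists s : {perm M}, (forall x, s (rot M x) = (rot M)^-1 (s x)) /\
                       (forall x, s (rev M x) = rev M (s x)).

Lemma dual_connected (M : oriented_map) :
  [transitive <<[set nextf M; rev M]>>, on [set: M] | 'P].
Proof.
suff -> : <<[set nextf M; rev M]>> = <<[set rot M; rev M]>>.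
  exact: map_connected.
apply/eqP; rewrite eqEsubset !gen_subG !subUset !sub1set.
set A := <<[set nextf M; rev M]>>; set B := <<[set rot M; rev M]>>.
have rB : rot M \in B by rewrite mem_gen ?set21.
have vB : rev M \in B by rewrite mem_gen ?set22.
have fA : nextf M \in A by rewrite mem_gen ?set21.
have vA : rev M \in A by rewrite mem_gen ?set22.
rewrite vB vA !andbT {1}/nextf groupM ?groupV //=.
suff -> : rot M = (nextf M)^-1 * rev M by rewrite groupM ?groupV.
by rewrite /nextf invMg invgK mulgKV.
Qed.

(* The arc [x] of the dual crosses the arc [x] of M from left to right, so that
   its initial vertex is the face to the left of [x]. *)
Definition dual (M : oriented_map) : oriented_map :=
  OrientedMap (@rev_neq M) (@rev_rev M) (dual_connected M).

Definition map_iso_dual (M N : oriented_map) : Prop :=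
  map_iso M N \/ map_iso (dual M) N.

(* MathComp's [\isog Grp] determines the largest finite quotient of the presented
   group; here this is the presented group itself, which is finite since <a, b>
   is an abelian normal subgroup generated by elements of order dividing p and
   its quotient is generated by the commuting images of c and d. *)
Definition isog_G0 (p t1 t2 : nat) (gT : finGroupType) (G : {group gT}) : Prop :=
  G \isog Grp (a : b : c : d :
    a ^+ p, b ^+ p, c ^+ 5, d ^+ 2, [~ a, b], (d * a) ^+ 2, (d * b) ^+ 2,
    c * a * c^-1 = b ^+ t2,
    c * b * c^-1 = (a * b) ^+ t1,
    d * c * d = a ^+ (t1 ^ 2)%N * b ^+ 2 * c).

(* Main.v *)
From HB Require Import structures.
From mathcomp Require Import all_boot all_order all_fingroup all_algebra.
From mathcomp Require Import cyclic finfield.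
From mathcomp Require Import ring zify.
Require Import Defs.

Set Implicit Arguments.
Unset Strict Implicit.
Unset Printing Implicit Defensive.

(** An orientably-regular map is determined by a group and a pair of generators.
    Fix an arc [x0] and let [R] and [S] be the orientation-preserving
    automorphisms that send [x0] to [rot x0] and [rev x0].  Since automorphisms
    commute with [rot] and [rev], labelling each arc by the automorphism that
    carries [x0] to it turns [rot] and [rev] into left multiplication by [R] and
    [S].  So the map is the Cayley map of [(Aut_plus, R, S)], with [R] of order
    the vertex degree and [S] an involution ([cayley_iso], [arc_aut_gen],
    [card_porbit_aut]), and any group isomorphism that carries one generating
    pair to another gives a map isomorphism.  The problem is to classify the
    pairs [(R, S)] of orders 10 and 2 that generate the presented group.

    Let [F] be the field with [p ^ 2] elements.  As [p = 9 %[mod 10]], the tenth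
    roots of unity lie in [F] but, except for [1] and [-1], not in the prime
    field.  The presented group is the group of affine maps
    [x |-> z ^+ i * x + v] of [F] ([affine_group_isoGrp]): with [z] a primitive
    tenth root of unity whose trace [z + z^-1] is [- t1], the relations hold for
    suitable affine maps that generate the group, and they force the order of
    any finite quotient to be at most [10 * p ^ 2] ([G0_rel_card]).

    Translations, homotheties and the Frobenius map act on this group.  An
    involution can be moved to [x |-> - x] by a translation; then [R] is
    [x |-> u * x + w] with [u] a primitive tenth root of unity and [w != 0], and
    a homothety makes [w = 1].  The Frobenius map replaces [u] by
    [u ^+ p = u^-1].  Hence only [u = z] and [u = z ^+ 3] remain
    ([normal_form]), which gives at most two maps
    ([affine_map_classification]); the same Frobenius map followed by a
    homothety inverts [R] and fixes [S], so both maps are reflexive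
    ([affine_map_reflexive]).  They are distinct because a word in [R] and [S]
    detects [u + u^-1] ([affine_map_noniso]), and neither is isomorphic to the
    dual of the other because faces and vertices have different sizes. *)

(** * Orbits of permutation groups *)

Section PermutationOrbits.
Import GroupScope.
Variable T : finType.
Implicit Types (A : {set {perm T}}) (D : {set T}).

(** Connectedness of a map is used only through this induction principle and its
    converse: a nonempty set of arcs closed under [rot] and [rev] is everything. *)
Lemma transitive_gen_ind A D x :
    [transitive <<A>>, on [set: T] | 'P] -> x \in D ->
  (forall a y, a \in A -> y \in D -> a y \in D) -> forall y, y \in D.
Proof.
move=> trA Dx clD y.
have: y \in orbit 'P <<A>> x by rewrite (atransP trA) ?inE.
have sAN: <<A>> \subset 'N(D | 'P).
  rewrite gen_subG; apply/subsetP=> a Aa; rewrite !inE.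
  by apply/subsetP=> u Du; rewrite inE /= apermE clD.
case/orbitP=> a /(subsetP sAN) Na <-.
by rewrite (astabs_act _ Na).
Qed.

Lemma transitive_genP A (x : T) :
    (forall D x, x \in D -> (forall a y, a \in A -> y \in D -> a y \in D) ->
       forall y, y \in D) ->
  [transitive <<A>>, on [set: T] | 'P].
Proof.
move=> ind; apply/imsetP; exists x => //; apply/setP=> y; rewrite inE.
symmetry; apply: ind (orbit_refl _ _ _) _ y => a u Aa xu.
by rewrite -apermE; apply: orbit_trans (mem_orbit _ _ (mem_gen Aa)) xu.
Qed.

Lemma card_porbit_free (s : {perm T}) (x : T) :
  {in <[s]>, forall a : {perm T}, a x = x -> a = 1} -> #|porbit s x| = #[s].
Proof.
move=> free; rewrite [@porbit]unlock card_in_imset // => a b sa sb /= eab.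
apply/eqP; rewrite eq_mulgV1; apply/eqP/free; first by rewrite groupM ?groupV.
by rewrite permM -[a x]/(aperm x a) eab /aperm permK.
Qed.

Lemma card_porbits_uniform (s : {perm T}) k :
  (forall x, #|porbit s x| = k) -> (#|porbits s| * k)%N = #|T|.
Proof.
move=> sk; rewrite -cardsT; symmetry; apply: card_uniform_partition.
  by move=> X /imsetP[x _ ->].

have -> : porbits s = orbit 'P <[s]> @: [set: T].
  by apply/setP=> X; apply/imsetP/imsetP=> -[x _ ->]; exists x;
    rewrite ?inE // porbit.unlock.
by apply/orbit_partition/subsetP=> a _; rewrite !inE; apply/subsetP=> x; rewrite !inE.
Qed.

End PermutationOrbits.

(** * Cayley maps *)

Section LeftMultiplication.
Import GroupScope.
Variable gT : finGroupType.
Implicit Types g h x : gT.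

(** The rotation system of a Cayley map acts by left multiplications.  Its
    automorphisms are then the right multiplications, and [rmul] is a
    homomorphism because permutations are composed from left to right. *)
Definition lmul g : {perm gT} := perm (mulgI g).
Definition rmul g : {perm gT} := perm (mulIg g).

Lemma lmulE g x : lmul g x = g * x. Proof. exact: permE. Qed.
Lemma rmulE g x : rmul g x = x * g. Proof. exact: permE. Qed.

Lemma lmulV g : (lmul g)^-1 = lmul g^-1.
Proof.
by apply/(mulgI (lmul g))/permP=> x; rewrite mulgV permM !lmulE mulKg perm1.
Qed.

Lemma lmulX g n : lmul g ^+ n = lmul (g ^+ n).
Proof.
apply/permP=> x; rewrite lmulE permX; elim: n => [|n IHn] /=; first by rewrite mul1g.
by rewrite IHn lmulE expgS mulgA.
Qed.

Lemma rmulM : {in [set: gT] &, {morph rmul : g h / g * h}}.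
Proof. by move=> g h _ _; apply/permP=> x; rewrite permM !rmulE mulgA. Qed.
Canonical rmul_morphism := Morphism rmulM.

Lemma injm_rmul : 'injm rmul_morphism.
Proof.
apply/subsetP=> g /kerP/= /(_ (in_setT _)) /permP/(_ 1).
by rewrite rmulE perm1 mul1g inE => ->.
Qed.

Lemma card_porbit_lmul g x : #|porbit (lmul g) x| = #[g].
Proof.
have free: {in <[lmul g]>, forall a : {perm gT}, a x = x -> a = 1}.
  move=> _ /cycleP[n ->]; rewrite lmulX lmulE -{2}[x]mul1g => /mulIg ->.
  by apply/permP=> y; rewrite lmulE perm1 mul1g.
rewrite (card_porbit_free free); apply/eqP; rewrite eqn_dvd; apply/andP; split.
  rewrite order_dvdn lmulX expg_order.
  by apply/eqP/permP=> y; rewrite lmulE perm1 mul1g.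
rewrite order_dvdn; apply/eqP; have /permP/(_ 1) := expg_order (lmul g).
by rewrite lmulX lmulE perm1 mulg1.
Qed.

End LeftMultiplication.

(** A map isomorphism between Cayley maps need not fix the identity, so it is
    not a homomorphism; but the pairs [(g, h)] it tracks form a subgroup, so that
    a relation between the generators of one map holds in the other. *)
Section Tracking.
Import GroupScope.
Variables (gT hT : finGroupType) (f : gT -> hT).
Definition tracks (g : gT) (h : hT) := forall x, f (g * x) = h * f x.

Lemma tracks1 h : tracks 1 h -> h = 1.
Proof. by move=> /(_ 1); rewrite mul1g -[LHS]mul1g => /mulIg ->. Qed.

Lemma tracksM g h g' h' : tracks g h -> tracks g' h' -> tracks (g * g') (h * h').
Proof. by move=> tg tg' x; rewrite -!mulgA tg tg'. Qed.

Lemma tracksV g h : tracks g h -> tracks g^-1 h^-1.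
Proof. by move=> tg x; apply: (mulgI h); rewrite -tg !mulKVg. Qed.

Lemma tracksX g h n : tracks g h -> tracks (g ^+ n) (h ^+ n).
Proof.
move=> tg; elim: n => [|n IHn]; first by move=> x; rewrite !mul1g.
by rewrite !expgS; apply: tracksM.
Qed.
(** When [r] acts on translations as multiplication by [u] and [s] as [-1], the
    commutator [v] of [r] and [s] is a translation and the word evaluates, in
    additive notation, to [(u^2 + t u + 1) v]; so it detects whether [u] and its
    inverse have sum [- t], which is an integral, hence group-theoretic,
    condition. *)
Definition trace_word (t : nat) (kT : finGroupType) (r s : kT) : kT :=
  let v := r * s * r^-1 * s in let rv := r * v * r^-1 in
  r * rv * r^-1 * rv ^+ t * v.

Lemma tracks_trace_word t r s r' s' :
  tracks r r' -> tracks s s' ->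
  tracks (trace_word t r s) (trace_word t r' s').
Proof.
by move=> tr ts; do ![apply: tracksX | apply: tracksV | apply: tracksM
                    | exact: tr | exact: ts].
Qed.

End Tracking.

Section CayleyMap.
Import GroupScope.
Variables (gT : finGroupType) (r s : gT).
Hypotheses (s_neq1 : s != 1) (s_invol : s * s = 1).
Hypothesis rs_gen : <<[set r; s]>> = [set: gT].

Lemma lgen_ind (D : {set gT}) x :
    x \in D -> (forall y, y \in D -> r * y \in D) ->
    (forall y, y \in D -> s * y \in D) ->
  forall y, y \in D.
Proof.
move=> Dx rD sD y.
have: y * x^-1 \in <<[set r; s]>> by rewrite rs_gen inE.
case/gen_prodgP=> n [c cP] def_y; rewrite -(mulgKV x y) {}def_y.
elim: n c cP => [|n IHn] c cP; first by rewrite big_ord0 mul1g.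
rewrite big_ord_recl -mulgA; have [] := set2P (cP ord0) => ->.
  by apply/rD/IHn=> i; apply: cP.
by apply/sD/IHn=> i; apply: cP.
Qed.

Lemma cayley_rev_neq x : lmul s x != x.
Proof. by rewrite lmulE -{2}[x]mul1g (inj_eq (mulIg x)). Qed.

Lemma cayley_rev_rev x : lmul s (lmul s x) = x.
Proof. by rewrite !lmulE mulgA s_invol mul1g. Qed.

Lemma cayley_connected :
  [transitive <<[set lmul r; lmul s]>>, on [set: gT] | 'P].
Proof.
apply: (transitive_genP 1) => D x Dx clD; apply: (lgen_ind Dx) => y Dy.
  by rewrite -lmulE clD ?set21.
by rewrite -lmulE clD ?set22.
Qed.

Definition cayley_map : oriented_map :=
  OrientedMap cayley_rev_neq cayley_rev_rev cayley_connected.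

(** An automorphism is determined by the image of the identity: the set of [y]
    where it agrees with a right multiplication is stable under the generators. *)
Lemma Aut_cayley : Aut_plus cayley_map = rmul_morphism gT @* [set: gT] :> {set _}.
Proof.
apply/setP=> a; apply/idP/idP=> [/centP ca | /morphimP[g _ _ ->]]; last first.
  by apply/centP=> b /set2P[]->; apply/permP=> x;
    rewrite !permM ?rmulE ?lmulE ?rmulE mulgA.
have ca' b : b \in [set lmul r; lmul s] -> forall x, a (b x) = b (a x).
  by move=> /ca /permP cab x; have := cab x; rewrite !permM.
suff aE y : y \in [set y | a y == y * a 1].
  rewrite morphimEdom; apply/imsetP; exists (a 1); first by rewrite inE.
  by apply/permP=> x; rewrite rmulE; have:= aE x; rewrite inE => /eqP.
apply: (@lgen_ind _ 1) => [|{}y|{}y]; rewrite !inE ?mul1g // => /eqP ay.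
  by rewrite -lmulE ca' ?set21 //= ay !lmulE mulgA.
by rewrite -lmulE ca' ?set22 //= ay !lmulE mulgA.
Qed.

Lemma Aut_cayley_isog : Aut_plus cayley_map \isog [set: gT].
Proof. by rewrite Aut_cayley isog_sym sub_isog ?injm_rmul. Qed.

Lemma cayley_regular : orientably_regular cayley_map.
Proof.
split=> [|x].
  apply/imsetP; exists (1 : gT) => //; apply/setP=> y; rewrite inE; symmetry.
  apply/orbitP; exists (rmul y); last by rewrite /= /aperm rmulE mul1g.
  by rewrite Aut_cayley; apply: (mem_morphim (rmul_morphism gT)); rewrite inE.
apply/trivgP/subsetP=> a /setIP[]; rewrite Aut_cayley => /morphimP[g _ _ ->].
move/astab1P; rewrite /= /aperm rmulE -{2}[x]mulg1 => /mulgI ->.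
by rewrite morph1 inE.
Qed.

Lemma nextf_cayley : nextf cayley_map = lmul (r^-1 * s).
Proof. by apply/permP=> x; rewrite /nextf /= lmulV permM !lmulE mulgA. Qed.

Lemma cayley_type : has_type cayley_map #[r^-1 * s] #[r].
Proof.
by split=> [f|v] /imsetP[x _ ->]; rewrite ?nextf_cayley card_porbit_lmul.
Qed.

Lemma card_vertices_cayley : (#|vertices cayley_map| * #[r])%N = #|gT|.
Proof. by apply: card_porbits_uniform => x; rewrite card_porbit_lmul. Qed.
Lemma card_edges_cayley : (#|edges cayley_map| * #[s])%N = #|gT|.
Proof. by apply: card_porbits_uniform => x; rewrite card_porbit_lmul. Qed.
Lemma card_faces_cayley : (#|faces cayley_map| * #[r^-1 * s])%N = #|gT|.
Proof.
by apply: card_porbits_uniform => x; rewrite nextf_cayley card_porbit_lmul.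
Qed.

End CayleyMap.

(** * Orientably-regular maps are Cayley maps *)

Section RegularMap.
Import GroupScope.
Variables (M : oriented_map) (x0 : M).
Hypothesis regM : orientably_regular M.
Let A := Aut_plus M.

(** By regularity the arcs are labelled by the automorphisms; the default value
    is never reached (see [arc_autP]). *)
Definition arc_aut (x : M) : {perm M} := odflt 1 [pick a in A | a x0 == x].

Lemma arc_autP x : arc_aut x \in A /\ arc_aut x x0 = x.
Proof.
rewrite /arc_aut; case: pickP => [a /andP[Aa /eqP] // | no].
have: x \in orbit 'P A x0 by rewrite (atransP regM.1) ?inE.
by case/orbitP=> a Aa ax; have:= no a; rewrite Aa -ax /= /aperm eqxx.
Qed.

Lemma aut_inj x : {in A &, injective (fun a : {perm M} => a x)}.
Proof.
move=> a b Aa Ab eab; apply/eqP; rewrite eq_mulgV1 -in_set1.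
rewrite -[[set 1]](regM.2 x) inE groupM ?groupV //.
by apply/astab1P; rewrite /= /aperm permM eab permK.
Qed.

Lemma arc_aut_uniq a : a \in A -> arc_aut (a x0) = a.
Proof. by move=> Aa; have [Ab bx] := arc_autP (a x0); apply: (aut_inj (x := x0)). Qed.

Lemma arc_aut_base : arc_aut x0 = 1.
Proof. by have:= arc_aut_uniq (group1 A); rewrite perm1. Qed.

(** A permutation [m] that commutes with the automorphisms becomes left
    multiplication in the labelling of the arcs, since
    [m (a x0) = a (m x0) = a (b x0)] where [b] is the label of [m x0]. *)
Lemma arc_autM (m : {perm M}) x : m \in 'C(A) ->
  arc_aut (m x) = arc_aut (m x0) * arc_aut x.
Proof.
move/centP=> cm; have [[Aa ax] [Ab bx]] := (arc_autP x, arc_autP (m x0)).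
suff ->: m x = (arc_aut (m x0) * arc_aut x) x0 by rewrite arc_aut_uniq ?groupM.
by rewrite permM bx -permM (cm _ Aa) permM ax.
Qed.

(** The cycle of [m] through [x0] is also a cycle of the label of [m x0], and
    automorphisms act freely; so sizes of vertices are orders of labels. *)
Lemma card_porbit_aut (m : {perm M}) : m \in 'C(A) ->
  #|porbit m x0| = #[arc_aut (m x0)].
Proof.
move=> cm; have [Aa ax] := arc_autP (m x0).
have sA: <[arc_aut (m x0)]> \subset A by rewrite cycle_subG.
rewrite -(@card_porbit_free _ _ x0) => [|b /(subsetP sA) Ab bx]; last first.
  by apply: (aut_inj (x := x0) Ab (group1 A)); rewrite perm1.
congr #|pred_of_set _|; apply/setP=> y.
have pow n : (m ^+ n) x0 = (arc_aut (m x0) ^+ n) x0.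
  elim: n => // n IHn; rewrite expgSr permM expgS permM ax IHn -!permM.
  by rewrite (centP cm) ?groupX.
by apply/porbitP/porbitP=> -[n ->]; exists n; rewrite pow.
Qed.

Lemma monodromy_cent : [/\ rot M \in 'C(A), rev M \in 'C(A) & nextf M \in 'C(A)].
Proof.
have sC: [set rot M; rev M] \subset 'C(A) by rewrite centsC.
have [Cr Cv] : rot M \in 'C(A) /\ rev M \in 'C(A).
  by split; apply: (subsetP sC); rewrite ?set21 ?set22.
by rewrite Cr Cv groupM ?groupV.
Qed.

Let R := arc_aut (rot M x0).
Let S := arc_aut (rev M x0).

Lemma arc_aut_rev_sq : S * S = 1.
Proof.
have [_ cv _] := monodromy_cent.
by rewrite -arc_autM // rev_rev arc_aut_base.
Qed.

Lemma arc_aut_rev_neq1 : S != 1.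
Proof.
apply/eqP=> S1; have [_ Sx] := arc_autP (rev M x0).
by have := rev_neq x0; rewrite -{1}Sx -/S S1 perm1 eqxx.
Qed.

(** The arcs whose label lies in the subgroup generated by [R] and [S] are
    stable under [rot] and [rev], and the map is connected. *)
Lemma arc_aut_gen : <<[set R; S]>> = A.
Proof.
have [cr cv _] := monodromy_cent.
apply/eqP; rewrite eqEsubset gen_subG subUset !sub1set.
rewrite (arc_autP _).1 (arc_autP _).1; apply/subsetP=> a Aa.
suff: a x0 \in [set x | arc_aut x \in <<[set R; S]>>] by rewrite inE arc_aut_uniq.
apply: (transitive_gen_ind (map_connected M) (x := x0)).
  by rewrite inE arc_aut_base group1.
by move=> b y /set2P[]->; rewrite !inE => gy;
  rewrite arc_autM ?groupM // mem_gen ?set21 ?set22.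
Qed.

(** The labelling followed by [h] carries [rot] and [rev] to the left
    multiplications by [r] and [s].  Taking for [h] an isomorphism onto a model
    of the automorphism group composed with automorphisms of the model, one
    gets map isomorphisms from algebra only. *)
Lemma cayley_iso (gT : finGroupType) (r s : gT) s1 s2 rsG (h : {perm M} -> gT) :
    {in A &, {morph h : a b / a * b}} -> {in A &, injective h} ->
    #|A| = #|gT| -> h R = r -> h S = s ->
  map_iso M (@cayley_map gT r s s1 s2 rsG).
Proof.
move=> hM hI cardA hR hS; have [cr cv _] := monodromy_cent.
have hE m x : m \in 'C(A) -> h (arc_aut (m x)) = h (arc_aut (m x0)) * h (arc_aut x).
  by move=> cm; rewrite arc_autM ?hM ?(arc_autP _).1.
exists (h \o arc_aut); split=> [|x|x] /=; last 2 first.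
- by rewrite lmulE hE // -/R hR.
- by rewrite lmulE hE // -/S hS.
apply: inj_card_bij => [x y|].
  move/hI => /(_ (arc_autP _).1 (arc_autP _).1) eqa.
  by rewrite -(arc_autP x).2 eqa (arc_autP y).2.
by rewrite -[#|gT|]cardA -(card_in_imset (aut_inj (x := x0))) max_card.
Qed.

End RegularMap.

(** * Duality *)

Section Dual.
Import GroupScope.
Variable M : oriented_map.

(** A map and its dual have the same monodromy group, hence the same centraliser. *)
Lemma Aut_dual : Aut_plus (dual M) = Aut_plus M.
Proof.
apply/val_inj/eqP; rewrite /= eqEsubset.
have [rA vA fA] := monodromy_cent M; have [rD vD fD] := monodromy_cent (dual M).
apply/andP; split; rewrite centsC subUset !sub1set ?vA ?fA ?vD ?andbT //.
suff -> : rot M = (rot (dual M))^-1 * rev (dual M) by rewrite groupM ?groupV.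
by rewrite /= /nextf invMg invgK mulgKV.
Qed.

Lemma regular_dual : orientably_regular M -> orientably_regular (dual M).
Proof. by case=> trM freeM; split; rewrite ?Aut_dual // => x; apply: freeM. Qed.

(** Going around a face of the dual is going around a vertex of the map, seen from
    the opposite arcs. *)
Lemma nextf_dual : nextf (dual M) = rev M * rot M * rev M.
Proof.
have vK: (rev M)^-1 = rev M.
  by apply/(mulgI (rev M))/permP=> x; rewrite mulgV permM rev_rev perm1.
by rewrite /nextf /= /nextf invMg invgK vK mulgA.
Qed.

Lemma type_dual m k : has_type M m k -> has_type (dual M) k m.
Proof.
case=> fm vk; split=> [_ /imsetP[x _ ->]|]; last exact: fm.
rewrite -(vk (porbit (rot M) (rev M x))); last exact: imset_f.
have eP y : (y \in porbit (nextf (dual M)) x)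
            = (rev M y \in porbit (rot M) (rev M x)).
  have pw n z : (nextf (dual M) ^+ n) z = rev M ((rot M ^+ n) (rev M z)).
    rewrite nextf_dual; elim: n z => [|n IHn] z; first by rewrite !perm1 rev_rev.
    by rewrite !expgSr !permM IHn rev_rev.
  apply/porbitP/porbitP=> -[n]; first by rewrite pw => ->; exists n; rewrite rev_rev.
  by move=> eq_n; exists n; rewrite pw -eq_n rev_rev.
rewrite -[RHS](card_imset _ (@perm_inj _ (rev M))); congr #|pred_of_set _|.
apply/(@setP M)=> y; rewrite -[y in RHS]rev_rev mem_imset; last exact: perm_inj.
exact: eP.
Qed.

End Dual.

(** * The presented group *)

Section Presentation.
Import GroupScope.
Variables p t1 t2 : nat.

Record G0_rel (gT : finGroupType) (a b c d : gT) : Prop := G0Rel {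
  rel_ap : a ^+ p = 1;
  rel_bp : b ^+ p = 1;
  rel_c5 : c ^+ 5 = 1;
  rel_d2 : d ^+ 2 = 1;
  rel_ab : [~ a, b] = 1;
  rel_da : (d * a) ^+ 2 = 1;
  rel_db : (d * b) ^+ 2 = 1;
  rel_ca : c * a * c^-1 = b ^+ t2;
  rel_cb : c * b * c^-1 = (a * b) ^+ t1;
  rel_dc : d * c * d = a ^+ (t1 ^ 2)%N * b ^+ 2 * c
}.

Definition hom_G0 (gT : finGroupType) (G : {group gT}) : bool :=
  G \homg Grp (a : b : c : d :
    a ^+ p, b ^+ p, c ^+ 5, d ^+ 2, [~ a, b], (d * a) ^+ 2, (d * b) ^+ 2,
    c * a * c^-1 = b ^+ t2,
    c * b * c^-1 = (a * b) ^+ t1,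
    d * c * d = a ^+ (t1 ^ 2)%N * b ^+ 2 * c).

Lemma hom_G0P (gT : finGroupType) (G : {group gT}) :
  reflect (exists a b c d, G0_rel a b c d /\
             <[a]> <*> <[b]> <*> <[c]> <*> <[d]> = G)
          (hom_G0 G).
Proof.
apply: (iffP existsP) => [[[[[a b] c] d]]|[a [b [c [d [rels genG]]]]]].
  rewrite /= !xpair_eqE => /and4P[/eqP genG /eqP ap /eqP bp].
  case/and5P=> /eqP c5 /eqP d2 /eqP ab /eqP da.
  case/and4P=> /eqP db /eqP ca /eqP cb /eqP dc.
  by exists a, b, c, d.
exists (a, b, c, d); rewrite /= !xpair_eqE genG eqxx.
by case: rels => -> -> -> -> -> -> -> -> -> ->; rewrite !eqxx.
Qed.

Lemma card_mul_leq (gT : finGroupType) (A B : {group gT}) :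
  #|A * B| <= #|A| * #|B|.
Proof. by rewrite mul_cardG leq_pmulr ?cardG_gt0. Qed.

(** In the chain [<<a, b>> <= <<a, b, c>> <= <<a, b, c, d>>] each term is
    normalised by the next generator, so every element is a product of powers of
    [a], [b], [c] and [d], in this order. *)
Lemma G0_rel_card (gT : finGroupType) (a b c d : gT) :
  0 < p -> G0_rel a b c d ->
  #|<[a]> <*> <[b]> <*> <[c]> <*> <[d]>| <= 10 * p ^ 2.
Proof.
move=> p_gt0 [ap bp c5 d2 ab da db ca cb dc].
have le_order (x : gT) n : 0 < n -> x ^+ n = 1 -> #|<[x]>| <= n.
  by move=> n_gt0 /eqP; rewrite -order_dvdn => /dvdn_leq; apply.
have dV : d^-1 = d by apply/(mulgI d); rewrite mulgV -d2 expgS expg1.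
pose N := <[a]> <*> <[b]>; pose L := N <*> <[c]>.
have [Na Nb] : a \in N /\ b \in N.
  by split; rewrite -cycle_subG (joing_subl, joing_subr).
have defN : N = <[a]> * <[b]>.
  rewrite /N cent_joinEr // cycle_subG; apply/centP=> _ /cycleP[n ->].
  exact/commuteX/commute_sym/commgP/eqP.
have nN (x : gT) : a ^ x \in N -> b ^ x \in N -> x \in 'N(N).
  by move=> ax bx; rewrite inE conjYg -!cycleJ join_subG !cycle_subG ax bx.
have nNc : <[c]> \subset 'N(N).
  rewrite cycle_subG -groupV nN //; rewrite conjgE invgK mulgA.
    by rewrite ca groupX.
  by rewrite cb groupX ?groupM.
have inv (x : gT) : (d * x) ^+ 2 = 1 -> x ^ d = x^-1.
  move=> dx; apply: (mulIg x); rewrite mulVg conjgE dV -dx.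
  by rewrite expgS expg1 !mulgA.
have nNd : d \in 'N(N) by rewrite nN // inv ?groupV.
have nLd : <[d]> \subset 'N(L).
  rewrite cycle_subG inE conjYg (normP nNd) -cycleJ join_subG joing_subl /=.
  rewrite cycle_subG conjgE dV mulgA dc groupM //.
    by rewrite (subsetP (joing_subl _ _)) ?groupM ?groupX.
  by rewrite -cycle_subG joing_subr.
rewrite -/N -/L norm_joinEr // (leq_trans (card_mul_leq _ _)) //.
have -> : (10 * p ^ 2 = p * p * 5 * 2)%N by rewrite -mulnA mulnn mulnC.
rewrite leq_mul ?le_order //= norm_joinEr // (leq_trans (card_mul_leq _ _)) //.
rewrite leq_mul ?le_order //= -/N defN (leq_trans (card_mul_leq _ _)) //.
by rewrite leq_mul ?le_order.
Qed.

Lemma G0_rel_pair (gT hT : finGroupType) (a b c d : gT) (a' b' c' d' : hT) :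
  G0_rel a b c d -> G0_rel a' b' c' d' ->
  @G0_rel (gT * hT)%type (a, a') (b, b') (c, c') (d, d').
Proof.
have pX (x : gT) (y : hT) n : (x, y) ^+ n = (x ^+ n, y ^+ n).
  by elim: n => // n IHn; rewrite !expgS IHn.
have pM (x u : gT) (y v : hT) : (x, y) * (u, v) = (x * u, y * v) by [].
have pV (x : gT) (y : hT) : (x, y)^-1 = (x^-1, y^-1) by [].
move=> [ap bp c5 d2 ab da db ca cb dc] [ap' bp' c5' d2' ab' da' db' ca' cb' dc'].
split; rewrite ?commgEl ?conjgE ?(pX, pM, pV) ?ap ?bp ?c5 ?d2 ?da ?db;
  rewrite ?ap' ?bp' ?c5' ?d2' ?da' ?db' ?ca ?ca' ?cb ?cb' ?dc ?dc' //.
by congr (_, _); [move: ab | move: ab']; rewrite commgEl conjgE.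
Qed.

(** Given another group [H] that satisfies the relations, the diagonal subgroup
    [K] of [H * G] satisfies them as well and projects onto [H] and [G].  By the
    bound on its order, its projection to [G] is bijective, so that [H] is an
    image of [G]. *)
Lemma isog_G0_of_card (hT : finGroupType) (G : {group hT}) :
  0 < p -> #|G| = (10 * p ^ 2)%N -> hom_G0 G -> isog_G0 p t1 t2 G.
Proof.
move=> p_gt0 cardG homG; apply: (intro_isoGrp homG) => gT H.
case/hom_G0P=> a [b [c [d [rels genH]]]].
have [a' [b' [c' [d' [rels' genG]]]]] := hom_G0P _ homG.
pose K := (<[(a, a')]> <*> <[(b, b')]> <*> <[(c, c')]> <*> <[(d, d')]>)%G.
have im1 : fst_morphism gT hT @* K = H.
  by rewrite !morphimY ?morphim_cycle ?subsetT ?inE //= genH.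
have im2 : snd_morphism gT hT @* K = G.
  by rewrite !morphimY ?morphim_cycle ?subsetT ?inE //= genG.
have leK : #|K| <= #|G| by rewrite cardG; apply/G0_rel_card/G0_rel_pair.
have isoGK : G \isog K by rewrite isogEcard leK -im2 morphim_homg ?subsetT.
by rewrite -im1 (eq_homgr _ isoGK) morphim_homg ?subsetT.
Qed.

End Presentation.

(** * The affine group of a field with tenth roots of unity *)

Section NaturalsInPositiveCharacteristic.
Import GRing.Theory.
Local Open Scope ring_scope.

Lemma natr_pchar_inj (F : fieldType) (p k l : nat) : p \in [pchar F] ->
  (k < p)%N -> (l < p)%N -> k%:R = l%:R :> F -> k = l.
Proof.
move=> pF; wlog le_kl : k l / (k <= l)%N => [hw|] kp lp kl.
  by case/orP: (leq_total k l) => ?; [|apply/esym]; apply: hw.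
have : (p %| l - k)%N by rewrite (dvdn_pcharf pF) natrB // kl subrr.
have [l0|l0] := posnP (l - k)%N; first by lia.
by move/(dvdn_leq l0); lia.
Qed.

End NaturalsInPositiveCharacteristic.

(** The pair [(v, i)] stands for the affine map [x |-> z ^+ i * x + v], and
    the product is composition.  The parameter [zP] makes exponents of [z]
    modulo 10 meaningful. *)
Definition affine_group (F : finFieldType) (z : F)
    of (10.-primitive_root z)%R : Type :=
  (F * 'Z_10)%type.

Section AffineGroup.
Import GRing.Theory GroupScope.
Local Open Scope ring_scope.
Variables (F : finFieldType) (z : F).
Hypothesis zP : 10.-primitive_root z.
Local Notation G := (affine_group zP).

HB.instance Definition _ := Finite.on G.

Definition aff (v : F) (i : 'Z_10) : G := (v, i).

Lemma zD (i j : 'Z_10) : z ^+ (i + j)%R = z ^+ i * z ^+ j.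
Proof. by rewrite /= (prim_expr_mod zP) exprD. Qed.

Lemma z_neq0 : z != 0. Proof. by rewrite (prim_root_eq0 zP). Qed.

Lemma zN (i : 'Z_10) : z ^+ (- i)%R = (z ^+ i)^-1.
Proof.
have zi0 : z ^+ i != 0 by rewrite expf_neq0 ?z_neq0.
by apply: (mulfI zi0); rewrite mulfV // -zD subrr.
Qed.

Definition aff_one : G := aff 0 0.
Definition aff_mul (g h : G) : G := aff (g.1 + z ^+ g.2 * h.1) (g.2 + h.2).
Definition aff_inv (g : G) : G := aff (- (z ^+ g.2)^-1 * g.1) (- g.2).

Lemma aff_mulA : associative aff_mul.
Proof.
by move=> g h k; rewrite /aff_mul /= zD addrA; congr (aff _ _); ring.
Qed.
Lemma aff_mul1 : left_id aff_one aff_mul.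
Proof. by case=> v i; rewrite /aff_mul /= expr0 mul1r !add0r. Qed.
Lemma aff_mulV : left_inverse aff_one aff_inv aff_mul.
Proof. by case=> v i; rewrite /aff_mul /= zN addNr mulNr addNr. Qed.

HB.instance Definition _ := Finite_isGroup.Build G aff_mulA aff_mul1 aff_mulV.

Lemma aff1 : (1%g : G) = aff 0 0. Proof. by []. Qed.
Lemma affM v w i j : (aff v i * aff w j)%g = aff (v + z ^+ i * w) (i + j).
Proof. by []. Qed.
Lemma affV v i : (aff v i)^-1%g = aff (- (z ^+ i)^-1 * v) (- i).
Proof. by []. Qed.
Lemma card_aff : #|{: G}| = (#|F| * 10)%N.
Proof. by rewrite card_prod card_ord. Qed.

Lemma aff_transX v n : (aff v 0 ^+ n)%g = aff (v *+ n) 0.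
Proof.
by elim: n => // n IHn; rewrite expgS IHn affM expr0 mul1r addr0 -mulrS.
Qed.

Lemma affX v i n : exists w, (aff v i ^+ n)%g = aff w (i *+ n).
Proof.
elim: n => [|n [w IHn]]; first by exists 0.
by exists (v + z ^+ i * w); rewrite expgS IHn affM mulrS.
Qed.

(** An affine map [g] with a linear part other than [1] has a unique fixed point;
    here, a power of [g] that is a translation commutes with [g], hence is
    trivial. *)
Lemma affX_eq1 v (i : 'Z_10) n : i != 0 -> i *+ n = 0 -> (aff v i ^+ n)%g = 1%g.
Proof.
move=> i0 in0; have [w wE] := affX v i n; rewrite wE in0.
have zi1 : 1 - z ^+ i != 0.
  rewrite subr_eq0 eq_sym -(prim_order_dvd zP) gtnNdvd ?ltn_ord //.
  by rewrite lt0n.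
have : commute (aff v i) (aff v i ^+ n)%g by apply: commuteX.
rewrite wE in0 => /(congr1 fst) /=; rewrite expr0 mul1r => /eqP.
rewrite -subr_eq0 (_ : _ - _ = - (1 - z ^+ i) * w); last by ring.
by rewrite mulNr oppr_eq0 mulf_eq0 (negPf zi1) /= => /eqP ->.
Qed.

Lemma zX_prim (i : 'Z_10) : coprime i 10 -> 10.-primitive_root (z ^+ i).
Proof. by move=> ci; rewrite prim_root_exp_coprime. Qed.

Variable p : nat.
Hypotheses (pF : p \in [pchar F]) (cardF : #|F| = (p ^ 2)%N).
Hypothesis p10 : p = 9 %[mod 10].

Let p_prime : prime p. Proof. exact: pcharf_prime pF. Qed.

(** [p + 1] is a multiple of 10. *)
Lemma primX_p (y : F) : 10.-primitive_root y -> y ^+ p = y^-1.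
Proof.
move=> yP; have y0 : y != 0 by rewrite (prim_root_eq0 yP).
apply: (mulfI y0); rewrite mulfV // -exprS -(prim_expr_mod yP).
by rewrite -addn1 -modnDml p10.
Qed.

(** A tenth root of unity [y] of order 10 is not in the prime field, where the
    Frobenius map is trivial; so [1] and [y] form a basis of [F]. *)
Lemma prime_field_basis (y x : F) : 10.-primitive_root y ->
  exists k l : nat, x = k%:R + l%:R * y.
Proof.
move=> yP; pose f (u : 'I_p * 'I_p) : F := u.1%:R + u.2%:R * y.
have frob (k : nat) : (k%:R : F) ^+ p = k%:R.
  exact: (pFrobenius_aut_nat pF).
have frobB (u v : F) : (u - v) ^+ p = u ^+ p - v ^+ p.
  exact: (pFrobenius_autB_comm pF (mulrC _ _)).
have natI (k l : 'I_p) : (k%:R : F) = l%:R -> k = l.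
  by move=> /(natr_pchar_inj pF (ltn_ord k) (ltn_ord l))/val_inj.
have f_inj : injective f.
  move=> [k l] [k' l']; rewrite /f /= => eqf.
  have [/natI ll|nll] := eqVneq (l%:R : F) l'%:R.
    by move: eqf; rewrite ll => /addIr/natI ->.
  have dl : (l'%:R : F) - l%:R != 0 by rewrite subr_eq0 eq_sym.
  have yE : y = (k%:R - k'%:R) / (l'%:R - l%:R).
    apply: (mulIf dl); rewrite divfK // mulrBr -[k%:R](addrK (l%:R * y)) eqf.
    by ring.
  have : y ^+ p = y by rewrite {1}yE exprMn exprVn !frobB !frob -yE.
  rewrite primX_p // => yV; have : y ^+ 2 = 1.
    by rewrite expr2 -{1}yV mulVf ?(prim_root_eq0 yP).
  by move/eqP; rewrite -(prim_order_dvd yP).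
have /codomP[[k l] ->] : x \in codom f; last by exists k, l.
by apply: inj_card_onto => //; rewrite card_prod !card_ord cardF mulnn.
Qed.

Lemma aff_conj w i v : (aff w i * aff v 0 * (aff w i)^-1)%g = aff (z ^+ i * v)%R 0.
Proof.
rewrite affV !affM addr0 subrr; congr aff.
by field; rewrite expf_neq0 ?z_neq0.
Qed.

(** Conjugation by [aff w j] multiplies translations by [z ^+ j], so that the
    translations in [K] form a subspace that contains a basis of [F]; and the
    linear parts of the powers of [aff w j] are all the powers of [z]. *)
Lemma affine_group_gen (K : {group G}) v w (j : 'Z_10) :
    v != 0 -> coprime j 10 -> aff v 0 \in K -> aff w j \in K ->
  K = [set: G] :> {set G}.
Proof.
move=> v0 cj Kv Kw; apply/eqP; rewrite eqEsubset subsetT /=.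
have Ktr x : aff x 0 \in K.
  have [k [l xE]] := prime_field_basis (x / v) (zX_prim cj).
  have -> : x = v *+ k + (z ^+ j * v) *+ l.
    by rewrite -[LHS](divfK v0) xE -(mulr_natr v k) -(mulr_natr (_ * v) l); ring.
  have Kzv : aff (z ^+ j * v) 0 \in K.
    by rewrite -(aff_conj w) !groupM ?groupV.
  have -> : aff (v *+ k + (z ^+ j * v) *+ l) 0
          = (aff v 0 ^+ k * aff (z ^+ j * v)%R 0 ^+ l)%g.
    by rewrite !aff_transX affM expr0 mul1r addr0.
  by rewrite groupM ?groupX.
apply/subsetP=> -[u i] _.
have jU : j \is a GRing.unit by rewrite -(natr_Zp j) unitZpE // coprime_sym.
pose n : nat := (i / j)%R; have [x xE] := affX w j n.
have jn : j *+ n = i by rewrite -mulr_natr natr_Zp mulrC divrK.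
have -> : (u, i) = (aff (u - x) 0 * aff w j ^+ n)%g.
  by rewrite xE jn affM expr0 mul1r subrK add0r.
by rewrite groupM ?groupX.
Qed.

Let p_gt0 : (0 < p)%N. Proof. exact: prime_gt0. Qed.

Lemma two_neq0 : (2%:R : F) != 0.
Proof.
rewrite -(dvdn_pcharf pF); apply/negP=> /dvdn_leq/= p2.
have := pcharf_prime pF; move: p10 (p2 isT).
by case: (p) => [|[|[|]]].
Qed.

Lemma zX5 : z ^+ 5 = -1.
Proof.
have z5 : z ^+ 5 != 1 by rewrite -(prim_order_dvd zP).
have: (z ^+ 5 - 1) * (z ^+ 5 + 1) = 0.
  by rewrite -subr_sqr expr1n -exprM (prim_expr_order zP) subrr.
by move/eqP; rewrite mulf_eq0 subr_eq0 (negPf z5) addr_eq0 => /eqP.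
Qed.

(** The normal forms of the two generators: the rotation about a vertex and the
    half-turn [x |-> - x] about an edge. *)
Definition rot_elt (i : 'Z_10) : G := aff 1 i.
Definition flip : G := aff 0 (inZp 5).

Lemma flip_sq : (flip * flip)%g = 1%g.
Proof. by rewrite /flip affM mulr0 addr0 aff1; congr aff; apply: val_inj. Qed.

Lemma flip_neq1 : flip != 1%g.
Proof. by apply/eqP=> /(congr1 snd). Qed.

Lemma rot_flip_comm (i : 'Z_10) :
  (rot_elt i * flip * (rot_elt i)^-1 * flip)%g = aff 2%:R 0.
Proof.
have zi0 : z ^+ i != 0 by rewrite expf_neq0 ?z_neq0.
rewrite /rot_elt /flip affV !affM mulr0 addr0 zD zX5; congr aff.
  by field.
by rewrite (addrAC i) subrr add0r; apply: val_inj.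
Qed.

Lemma rot_flip_gen (i : 'Z_10) : coprime i 10 ->
  <<[set rot_elt i; flip]>>%g = [set: G].
Proof.
move=> ci; pose K := <<[set rot_elt i; flip]>>%G.
have rK : rot_elt i \in K by rewrite mem_gen ?set21.
have fK : flip \in K by rewrite mem_gen ?set22.
apply: (@affine_group_gen K 2%:R 1 i) => //; first exact: two_neq0.
by rewrite -(rot_flip_comm i) !groupM ?groupV.
Qed.

Lemma order_flip : #[flip]%g = 2%N.
Proof. by apply: nt_prime_order; [ | exact: flip_sq | exact: flip_neq1]. Qed.

Lemma order_aff (v : F) (i : 'Z_10) : coprime i 10 -> #[aff v i]%g = 10%N.
Proof.
move=> ci; have iU : i \is a GRing.unit.
  by rewrite -(natr_Zp i) unitZpE // coprime_sym.
have i0 : i != 0 by apply: contraTneq iU => ->; rewrite unitr0.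
have i10 : i *+ 10 = 0 by rewrite -mulr_natr pchar_Zp ?mulr0.
apply/eqP; rewrite eqn_dvd order_dvdn affX_eq1 ?eqxx ?andTb //.
have [w] := affX v i #[aff v i]%g.
rewrite expg_order => /(congr1 snd) /= wE.
have /eqP : i * (#[aff v i]%g)%:R = i * 0 by rewrite mulr_natr -wE mulr0.
by rewrite (inj_eq (mulrI iU)) -(inj_eq val_inj) /= val_Zp_nat.
Qed.

(** The rotation about a face has linear part of exponent [5 - i], which is even
    and nonzero modulo 10 when [i] is prime to 10. *)
Lemma Z10_opposite_even (i : 'Z_10) :
  coprime i 10 -> i != inZp 5 /\ (inZp 5 - i) *+ 5 = 0.
Proof.
case: i => [[|[|[|[|[|[|[|[|[|[|//]]]]]]]]]] ilt] //= _;
  by split=> //; apply: val_inj.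
Qed.

Lemma order_face (i : 'Z_10) :
  coprime i 10 -> #[(rot_elt i)^-1 * flip]%g = 5%N.
Proof.
move=> /Z10_opposite_even[i5 fi]; rewrite /rot_elt /flip affV affM (addrC (- i)).
have i0 : inZp 5 - i != 0 by rewrite subr_eq0 eq_sym.
apply: nt_prime_order; [by [] | exact: affX_eq1 |].
by apply/eqP=> /(congr1 snd) /= /eqP; rewrite (negPf i0).
Qed.

(** Automorphisms induced by a homothety and by the Frobenius map; the latter
    sends [z ^+ i] to [z ^+ (- i)] by [primX_p]. *)
Definition scale (l : F) (g : G) : G := aff (l * g.1) g.2.
Definition galois (g : G) : G := aff (g.1 ^+ p) (- g.2).

Lemma scaleM l : {morph scale l : g h / (g * h)%g}.
Proof. by move=> [v i] [w j]; rewrite /scale affM /=; congr aff; ring. Qed.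

Lemma scale_inj l : l != 0 -> injective (scale l).
Proof. by move=> l0 [v i] [w j] [/(mulfI l0) -> ->]. Qed.

Lemma exppD (u v : F) : (u + v) ^+ p = u ^+ p + v ^+ p.
Proof. exact: (pFrobenius_autD_comm pF (mulrC _ _)). Qed.

Lemma expp_inj : injective (fun v : F => v ^+ p).
Proof. exact: (fmorph_inj (pFrobenius_aut pF)). Qed.

Lemma galoisM : {morph galois : g h / (g * h)%g}.
Proof.
move=> [v i] [w j]; rewrite /galois affM /= opprD exppD exprMn.
by rewrite zN -(exprAC z) (primX_p zP) exprVn.
Qed.

Lemma galois_inj : injective galois.
Proof.
move=> [v i] [w j] eg; have /= -> := expp_inj (congr1 fst eg).
by have /= -> := oppr_inj (congr1 snd eg).
Qed.

Lemma scale_flip l : scale l flip = flip.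
Proof. by rewrite /scale /= mulr0. Qed.

Lemma galois_flip : galois flip = flip.
Proof.
rewrite /galois /flip /= expr0n eqn0Ngt p_gt0.
by congr aff; apply: val_inj.
Qed.

(** The Frobenius map sends [rot_elt i] to [rot_elt (- i)], and
    [(rot_elt i)^-1] has the same linear part and the vector [- (z ^+ i)^-1], whence
    the homothety. *)
Definition reflector (i : 'Z_10) (g : G) : G := scale (- (z ^+ i)^-1) (galois g).

Lemma reflector_rot i : reflector i (rot_elt i) = (rot_elt i)^-1%g.
Proof. by rewrite /reflector /galois /scale /rot_elt affV /= expr1n. Qed.

Lemma reflector_flip i : reflector i flip = flip.
Proof. by rewrite /reflector galois_flip scale_flip. Qed.

Lemma Z10_involution (j : 'Z_10) : j + j = 0 -> j = 0 \/ j = inZp 5.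
Proof.
move=> /eqP; case: j => [[|[|[|[|[|[|[|[|[|[|//]]]]]]]]]] j] //= _.
  by left; apply: val_inj.
by right; apply: val_inj.
Qed.

(** The exponents of elements of order 10 are the units modulo 10; up to sign they
    are [1] and [3]. *)
Lemma Z10_cases (i : 'Z_10) :
  [\/ i = 0, i *+ 5 = 0 | i *+ 2 = 0] \/
  [\/ i = 1, i = inZp 3, - i = 1 | - i = inZp 3].
Proof.
case: i => [[|[|[|[|[|[|[|[|[|[|//]]]]]]]]]] ilt] //=.
- by left; constructor 1; apply: val_inj.
- by right; constructor 1; apply: val_inj.
- by left; constructor 2; apply: val_inj.
- by right; constructor 2; apply: val_inj.
- by left; constructor 2; apply: val_inj.
- by left; constructor 3; apply: val_inj.
- by left; constructor 2; apply: val_inj.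
- by right; constructor 4; apply: val_inj.
- by left; constructor 2; apply: val_inj.
- by right; constructor 3; apply: val_inj.
Qed.

(** The pairs of noncommuting elements of orders 10 and 2 fall into at most two
    classes under automorphisms: the centre of the half-turn [h] is moved to the
    origin, then a homothety and, if necessary, the Frobenius map bring [g] to
    normal form. *)
Lemma normal_form (g h : G) :
    #[g]%g = 10%N -> #[h]%g = 2%N -> ~ commute g h ->
  exists theta : G -> G,
    [/\ {morph theta : x y / (x * y)%g}, injective theta, theta h = flip
      & theta g = rot_elt 1 \/ theta g = rot_elt (inZp 3)].
Proof.
case: g h => [v i] [w j] og oh cgh.
rewrite -/(aff v i) -/(aff w j) in og oh cgh *.
have j5 : j = inZp 5.
  have : (aff w j ^+ 2)%g = 1%g by rewrite -oh expg_order.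
  rewrite expgS expg1 affM => w2; have [j0|//] := Z10_involution (congr1 snd w2).
  move/(congr1 fst): w2 => /=; rewrite j0 expr0 mul1r -mulr2n -mulr_natr => /eqP.
  rewrite mulf_eq0 (negPf two_neq0) orbF => /eqP w0.
  by move: oh; rewrite w0 j0 order1.
(* The fixed point of [h]. *)
pose x := w / 2%:R; pose t := aff (- x) 0.
pose theta0 (g : G) := (t * g * t^-1)%g.
have theta0M : {morph theta0 : g h / (g * h)%g}.
  by move=> g h; rewrite /theta0 !mulgA mulgKV.
have theta0I : injective theta0 by move=> g h /mulIg/mulgI.
have theta0E u k : theta0 (aff u k) = aff (u - x + z ^+ k * x) k.
  rewrite /theta0 /t affV !affM add0r oppr0 addr0 expr0 invr1; congr aff.
  by ring.
have theta0h : theta0 (aff w j) = flip.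
  rewrite theta0E j5 zX5; congr aff; rewrite /x.
  by field; rewrite two_neq0.
set u := v - x + z ^+ i * x in theta0E.
have theta0g : theta0 (aff v i) = aff u i by rewrite theta0E.
(* Otherwise [g] and [h] would have the same fixed point and commute. *)
have u0 : u != 0.
  apply/eqP=> u0; apply: cgh; apply: theta0I.
  by rewrite !theta0M theta0h theta0g u0 /flip !affM !mulr0 (addrC i).
(* Translations have order dividing [p]. *)
have i_neq0 : i != 0.
  apply/eqP=> i0; have : (#[aff v i]%g %| p)%N.
    by rewrite order_dvdn i0 aff_transX mulrn_pchar ?eqxx.
  by rewrite og /dvdn p10.
have order_i n : i *+ n = 0 -> (10 %| n)%N.
  by move=> in0; rewrite -og order_dvdn affX_eq1.
have [[i0|/order_i//|/order_i//]|] := Z10_cases i; first by rewrite i0 in i_neq0.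
pose theta1 := scale u^-1 \o theta0.
pose theta2 := scale (u ^+ p)^-1 \o galois \o theta0.
have up0 : u ^+ p != 0 by rewrite expf_neq0.
have theta1P : [/\ {morph theta1 : x y / (x * y)%g}, injective theta1,
    theta1 (aff w j) = flip & theta1 (aff v i) = rot_elt i].
  split=> [g h|||]; rewrite /theta1 /= ?theta0h ?theta0g ?scale_flip //.
  - by rewrite theta0M scaleM.
  - by apply: inj_comp theta0I; apply: scale_inj; rewrite invr_neq0.
  by rewrite /scale /= mulVf.
have theta2P : [/\ {morph theta2 : x y / (x * y)%g}, injective theta2,
    theta2 (aff w j) = flip & theta2 (aff v i) = rot_elt (- i)].
  split=> [g h|||]; rewrite /theta2 /= ?theta0h ?theta0g ?galois_flip ?scale_flip //.
  - by rewrite theta0M galoisM scaleM.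
  - apply: inj_comp theta0I; apply: inj_comp galois_inj.
    by apply: scale_inj; rewrite invr_neq0.
  by rewrite /scale /= mulVf.
case: theta1P theta2P => [M1 I1 f1 r1] [M2 I2 f2 r2].
by case=> iE; [exists theta1 | exists theta1 | exists theta2 | exists theta2];
  split; rewrite // ?r1 ?r2 iE; auto.
Qed.

Lemma trace_wordE (t : nat) (i : 'Z_10) :
  trace_word t (rot_elt i) flip = aff (2%:R * ((z ^+ i) ^+ 2 + t%:R * z ^+ i + 1)) 0.
Proof.
rewrite /trace_word rot_flip_comm /rot_elt !aff_conj aff_transX.
rewrite !affM expr0 !mul1r !addr0.
by congr aff; rewrite /= -(mulr_natr (_ * _) t); ring.
Qed.

(** * The presentation of the affine group *)

Variables t1 t2 : nat.
Hypotheses (zt1 : z ^+ 2 + t1%:R * z + 1 = 0) (t12p : t1%:R * t2%:R = -1 :> F).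

(** [a] and [b] are translations, [flip] plays the role of [d], and [c] has linear
    part [z ^+ 6 = - z], a fifth root of unity.  The relations that give
    [c * a * c^-1] and [c * b * c^-1] say that this root has trace [t1]; the
    vectors of [b] and [c] are then read off from the relations for
    [c * a * c^-1] and [flip * c * flip]. *)
Lemma affine_group_rel : exists a b c d : G, G0_rel p t1 t2 a b c d /\
  (<[a]> <*> <[b]> <*> <[c]> <*> <[d]>)%g = [set: G].
Proof.
pose m : F := - (t1%:R ^+ 2 + 2%:R * t1%:R * z) / 2%:R.
pose a := aff 1 0; pose b := aff (t1%:R * z) 0; pose c := aff m (inZp 6).
exists a, b, c, flip.
have z6 : z ^+ 6 = - z by rewrite exprS zX5 mulrN1.
have i5 v : (aff v (inZp 5) ^+ 2)%g = 1%g.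
  by apply: affX_eq1 => //; apply: val_inj.
split; last first.
  pose K := (<[a]> <*> <[b]> <*> <[c]> <*> <[flip]>)%G.
  have [Ka Kc Kd] : [/\ a \in K, c \in K & flip \in K].
    split; rewrite -cycle_subG.
    - by rewrite /K /= !(subset_trans _ (joing_subl _ _)).
    - by rewrite (subset_trans _ (joing_subl _ _)) ?joing_subr.
    - by rewrite joing_subr.
  (* [c * flip] has exponent [6 + 5 = 1] modulo 10. *)
  apply: (@affine_group_gen K 1 (c * flip)%g.1 1) => //; first exact: oner_neq0.
  rewrite (_ : aff _ _ = (c * flip)%g) ?groupM // /c /flip affM.
  by congr aff; apply: val_inj.
split.
- by rewrite aff_transX mulrn_pchar.
- by rewrite aff_transX mulrn_pchar.
- by apply: affX_eq1 => //; apply: val_inj.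
- exact: flip_sq.
- by apply/eqP/commgP; rewrite /commute !affM !expr0 !mul1r addrC.
- by rewrite affM addr0 i5.
- by rewrite affM addr0 i5.
- rewrite aff_conj aff_transX z6 -(mulr_natr (_ * z) t2); congr aff.
  by rewrite (mulrAC t1%:R) t12p; ring.
- rewrite aff_conj affM expr0 mul1r addr0 aff_transX z6.
  rewrite -(mulr_natr (_ + _) t1); congr aff.
  apply/eqP; rewrite -subr_eq0; apply/eqP.
  by rewrite -[RHS](mulr0 (- t1%:R)) -zt1; ring.
rewrite !aff_transX /flip !affM !expr0 !mul1r !mulr0 !addr0 zX5.
rewrite -(mulr_natr (_ * z) 2) natrX add0r mulN1r.
congr aff; last by apply: val_inj.
by rewrite /= /m; field; exact: two_neq0.
Qed.

Lemma affine_group_isoGrp : isog_G0 p t1 t2 [set: G]%G.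
Proof.
apply: isog_G0_of_card => //; first by rewrite cardsT card_aff cardF mulnC.
by apply/hom_G0P; have [a [b [c [d ?]]]] := affine_group_rel; exists a, b, c, d.
Qed.

(** * The two maps *)

(** Both [z] and [z ^+ 3] would be roots of [X^2 + t1 X + 1], whose roots are [z]
    and its inverse. *)
Lemma trace_word_neq (f : G -> G) :
  tracks f (rot_elt 1) (rot_elt (inZp 3)) -> tracks f flip flip -> False.
Proof.
move=> tr ts; have := tracks_trace_word t1 tr ts.
rewrite !trace_wordE /= expr1 zt1 mulr0 => /tracks1/(congr1 fst) /= /eqP.
rewrite mulf_eq0 (negPf two_neq0) /= => /eqP z3.
have : (z ^+ 4 - 1) * (z ^+ 2 - 1) = 0.
  have -> : (z ^+ 4 - 1) * (z ^+ 2 - 1) = (z ^+ 3 ^+ 2 + t1%:R * z ^+ 3 + 1)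
     - z ^+ 2 * (z ^+ 2 + t1%:R * z + 1) by ring.
  by rewrite z3 zt1; ring.
by move/eqP; rewrite mulf_eq0 !subr_eq0 -!(prim_order_dvd zP).
Qed.

Definition affine_map (i : 'Z_10) (ci : coprime i 10) : oriented_map :=
  cayley_map flip_neq1 flip_sq (rot_flip_gen ci).

Lemma coprime1 : coprime (1%R : 'Z_10) 10. Proof. by []. Qed.
Lemma coprime3 : coprime (inZp 3 : 'Z_10) 10. Proof. by []. Qed.

Lemma affine_map_type i ci : has_type (@affine_map i ci) 5 10.
Proof.
have := cayley_type flip_neq1 flip_sq (rot_flip_gen ci).
by rewrite order_face // order_aff.
Qed.

Lemma affine_map_euler i ci :
  euler_char (@affine_map i ci) = - (2 * p%:Z ^+ 2).
Proof.
have cG : #|{: G}| = (p ^ 2 * 10)%N by rewrite card_aff cardF.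
have := card_vertices_cayley flip_neq1 flip_sq (rot_flip_gen ci).
have := card_edges_cayley flip_neq1 flip_sq (rot_flip_gen ci).
have := card_faces_cayley flip_neq1 flip_sq (rot_flip_gen ci).
rewrite order_face // order_flip order_aff // cG /euler_char /affine_map.
move: #|_| #|_| #|_| => nf ne nv Ef Ee Ev.
have -> : p%:Z ^+ 2 = (p ^ 2)%N%:Z by rewrite -mulnn PoszM expr2.
lia.
Qed.

Lemma affine_map_reflexive i ci : reflexive_map (@affine_map i ci).
Proof.
have rI : injective (reflector i).
  move=> g h /scale_inj -/(_ _)/galois_inj; apply.
  by rewrite oppr_eq0 invr_neq0 // expf_neq0 ?z_neq0.
have rM : {morph reflector i : g h / (g * h)%g}.
  by move=> g h; rewrite /reflector galoisM scaleM.
exists (perm rI); split=> x.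
  by rewrite /= lmulV !lmulE !permE rM reflector_rot.
by rewrite /= !lmulE !permE rM reflector_flip.
Qed.

(** An isomorphism from the dual would track the rotation about a face, of order 5,
    to the rotation about a vertex, of order 10. *)
Lemma affine_map_noniso :
  ~ map_iso_dual (affine_map coprime1) (affine_map coprime3).
Proof.
case=> -[f [_ fr fs]].
  apply: (@trace_word_neq f) => x; first by have := fr x; rewrite /= !lmulE.
  by have := fs x; rewrite /= !lmulE.
have tr : tracks f ((rot_elt 1%R)^-1 * flip)%g (rot_elt (inZp 3)).
  move=> x; have : f (nextf (affine_map coprime1) x) = _ := fr x.
  by rewrite nextf_cayley /= !lmulE.
have o5 : #[(rot_elt 1%R)^-1 * flip]%g = 5%N by apply: order_face.
have := tracksX 5 tr; rewrite -[X in (_ ^+ X)%g]o5 expg_order => /tracks1/eqP.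
by rewrite -order_dvdn order_aff.
Qed.

(** The two generating automorphisms have orders 10 and 2, and they do not commute
    since the group they generate is not abelian; so [normal_form] applies. *)
Lemma affine_map_classification (M : oriented_map) :
    orientably_regular M -> isog_G0 p t1 t2 (Aut_plus M) -> has_type M 5 10 ->
  map_iso M (affine_map coprime1) \/ map_iso M (affine_map coprime3).
Proof.
move=> regM isoA [_ type10].
have isoG := affine_group_isoGrp.
have AG : Aut_plus M \isog [set: G].
  rewrite isogEhom (isoA _ [set: G]%G) (isoG _ (Aut_plus M)).
  by rewrite (isoGrp_hom isoG) (isoGrp_hom isoA).
have [x0 _ _] := imsetP regM.1.
have [cr _ _] := monodromy_cent M.
set A := Aut_plus M in isoA AG cr.
have [phi injphi imphi] := isogP AG.
pose R := arc_aut x0 (rot M x0); pose S := arc_aut x0 (rev M x0).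
have [AR _] := arc_autP x0 regM (rot M x0).
have [AS _] := arc_autP x0 regM (rev M x0).
have oR : #[phi R]%g = 10%N.
  rewrite (order_injm injphi) // -card_porbit_aut // type10 //.
  exact: imset_f.
have oS : #[phi S]%g = 2%N.
  rewrite (order_injm injphi) //; apply: nt_prime_order => //.
    exact: arc_aut_rev_sq.
  exact: arc_aut_rev_neq1.
have ncRS : ~ commute (phi R) (phi S).
  move=> cRS; have {}cRS : commute R S.
    by apply: (injmP injphi); rewrite ?groupM // !morphM.
  have abG : abelian [set: G].
    rewrite -imphi morphim_abelian // -(arc_aut_gen x0 regM) abelian_gen.
    apply/centsP=> _ /set2P[]-> _ /set2P[]->;
      first [exact: commute_refl | exact: cRS | exact: (commute_sym cRS)].
  have := centsP abG (aff 1 0) (in_setT _) flip (in_setT _).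
  rewrite /commute !affM zX5 => /(congr1 fst)/eqP/=.
  by rewrite mulr0 addr0 add0r mulr1 -subr_eq0 opprK (negPf two_neq0).
have [theta [tM tI tS tR]] := normal_form oR oS ncRS.
have hM : {in A &, {morph theta \o phi : a b / (a * b)%g}}.
  by move=> a b Aa Ab; rewrite /= morphM ?tM.
have hI : {in A &, injective (theta \o phi)}.
  by move=> a b Aa Ab /tI; apply: (injmP injphi).
have cA : #|A| = #|{: G}| by rewrite (card_isog AG) cardsT.
by case: tR => tR; [left | right];
  apply: (@cayley_iso M x0 regM _ _ _ _ _ _ _ hM hI cA).
Qed.

End AffineGroup.

(** * Tenth roots of unity and the roots [t1] and [t2] *)

Section Arithmetic.
Import GRing.Theory.
Local Open Scope ring_scope.

Lemma finField_prim_root (F : finFieldType) n :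
  (n %| #|F|.-1)%N -> exists z : F, n.-primitive_root z.
Proof.
move=> n_dvd; pose rs := [seq x <- enum F | x != 0].
have F_gt1 : (1 < #|F|)%N := finNzRing_gt1 F.
have rs1 : all (#|F|.-1).-unity_root rs.
  apply/allP=> x; rewrite mem_filter => /andP[x0 _]; apply/unity_rootP.
  by apply: (mulfI x0); rewrite -exprS prednK ?mulr1 ?expf_card // ltnW.
have sz : (#|F|.-1 <= size rs)%N.
  have -> : size rs = #|[set~ (0 : F)]|.
    rewrite cardE /enum_mem -enumT; congr size.
    by apply: eq_filter => x; rewrite !inE.
  by rewrite cardsC1.
have /hasP[z _ zP] : has (#|F|.-1).-primitive_root rs.
  apply: has_prim_root => //; first by rewrite -ltnS prednK // ltnW.
  by rewrite filter_uniq ?enum_uniq.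
by exists (z ^+ (#|F|.-1 %/ n)); apply: dvdn_prim_root.
Qed.

Lemma root_mod_pchar (F : fieldType) (p t : nat) : p \in [pchar F] ->
    (t%:Z ^+ 2 + t%:Z - 1 = 0 %[mod p])%Z ->
  t%:R ^+ 2 + t%:R - 1 = 0 :> F.
Proof.
move=> pF /eqP; rewrite eqz_mod_dvd subr0 => /dvdzP[q].
move/(congr1 (fun m : int => m%:~R : F)).
have p0 : (p%:Z)%:~R = 0 :> F := pcharf0 pF.
by rewrite rmorphM /= p0 mulr0 rmorphB rmorphD rmorphXn.
Qed.

Lemma mod10_of_mod5 (p : nat) : prime p -> (19 <= p)%N ->
  (p%:Z = -1 %[mod 5])%Z -> p = 9 %[mod 10].
Proof.
move=> pr p19; rewrite modz_nat => p5.
have p_odd : odd p by have [p2|//] := even_prime pr; rewrite p2 in p19.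
lia.
Qed.

(** The polynomials [X^2 + t X + 1] for [t = t1, t2] have as product the tenth
    cyclotomic polynomial, so a primitive tenth root of unity [y] is a root of
    one of them; if it is the wrong one, [y ^+ 3] is a root of the other. *)
Lemma prim_root10_trace (F : fieldType) (y t1 t2 : F) :
    10.-primitive_root y -> t1 != t2 ->
    t1 ^+ 2 + t1 - 1 = 0 -> t2 ^+ 2 + t2 - 1 = 0 ->
  t1 * t2 = -1 /\ exists z : F, 10.-primitive_root z /\ z ^+ 2 + t1 * z + 1 = 0.
Proof.
move=> yP t12 r1 r2.
have s12 : t1 + t2 = -1.
  have : (t1 - t2) * (t1 + t2 + 1) = 0.
    rewrite (_ : _ * _ = (t1 ^+ 2 + t1 - 1) - (t2 ^+ 2 + t2 - 1)); last by ring.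
    by rewrite r1 r2 subrr.
  by move/eqP; rewrite mulf_eq0 subr_eq0 (negPf t12) addr_eq0 => /eqP.
have t2E : t2 = - 1 - t1 by rewrite -s12; ring.
(* The tenth cyclotomic polynomial. *)
have y5 : y ^+ 4 - y ^+ 3 + y ^+ 2 - y + 1 = 0.
  have : (y ^+ 5 - 1) * (y + 1) * (y ^+ 4 - y ^+ 3 + y ^+ 2 - y + 1) = 0.
    rewrite (_ : _ * _ = y ^+ 10 - 1); last by ring.
    by rewrite (prim_expr_order yP) subrr.
  have y1 : y + 1 != 0.
    rewrite addr_eq0; apply/eqP=> yN; have := prim_order_dvd yP 2.
    by rewrite yN sqrrN expr1n eqxx.
  by move/eqP; rewrite !mulf_eq0 subr_eq0 -(prim_order_dvd yP) (negPf y1) => /eqP.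
have y0 : y != 0 by rewrite (prim_root_eq0 yP).
have t12p : t1 * t2 = -1 by rewrite t2E -[RHS]subr0 -r1; ring.
split=> //; have : (y ^+ 2 + t1 * y + 1) * (y ^+ 2 + t2 * y + 1) = 0.
  have -> : (y ^+ 2 + t1 * y + 1) * (y ^+ 2 + t2 * y + 1) =
      y ^+ 4 + (t1 + t2) * y ^+ 3 + (2%:R + t1 * t2) * y ^+ 2 + (t1 + t2) * y + 1.
    by ring.
  by rewrite s12 t12p -[RHS]y5; ring.
move/eqP; rewrite mulf_eq0 => /orP[] /eqP yt; first by exists y.
exists (y ^+ 3); split; first by rewrite prim_root_exp_coprime.
rewrite (_ : _ + _ = (y * (y + 1) + 1) * (y ^+ 4 - y ^+ 3 + y ^+ 2 - y + 1)
   - y ^+ 2 * (y ^+ 2 + t2 * y + 1)); last by rewrite t2E; ring.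
by rewrite y5 yt !mulr0 subr0.
Qed.

End Arithmetic.

Theorem corollaryD2 (p t1 t2 : nat)
  (p_prime : prime p) (p_ge19 : (19 <= p)%N)
  (p_mod5 : (p%:Z = -1 %[mod 5])%Z)
  (t1_range : (1 <= t1 <= p.-1)%N) (t2_range : (1 <= t2 <= p.-1)%N)
  (t1_neq_t2 : t1 <> t2)
  (t1_root : (t1%:Z ^+ 2 + t1%:Z - 1 = 0 %[mod p])%Z)
  (t2_root : (t2%:Z ^+ 2 + t2%:Z - 1 = 0 %[mod p])%Z) :
  let good (M : oriented_map) : Prop :=
    [/\ orientably_regular M,
        euler_char M = (- (2 * p%:Z ^+ 2))%R
      & isog_G0 p t1 t2 (Aut_plus M)] in
  exists M1 M2 : oriented_map,
    [/\ good M1 /\ has_type M1 5 10,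
        good M2 /\ has_type M2 5 10,
        ~ map_iso_dual M1 M2,
        forall M : oriented_map,
          good M -> has_type M 5 10 \/ has_type M 10 5 ->
          map_iso_dual M M1 \/ map_iso_dual M M2
      & reflexive_map M1 /\ reflexive_map M2].
Proof.
move=> good; have p10 := mod10_of_mod5 p_prime p_ge19 p_mod5.
have [F pF cardF] := pPrimePowerField p_prime (isT : 0 < 2).
have [y yP] : exists y : F, 10.-primitive_root%R y.
  apply: finField_prim_root; rewrite cardF -subn1 -(exp1n 2) subn_sqr.
  (* [10] divides [p + 1], hence [p ^ 2 - 1]. *)
  rewrite dvdn_mull //; apply/dvdnP; exists (p %/ 10).+1; lia.
have t12 : (t1%:R != t2%:R :> F)%R.
  by apply/eqP=> /(natr_pchar_inj pF) e; apply: t1_neq_t2; apply: e; lia.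
have [t12p [z [zP zt1]]] := prim_root10_trace yP t12
  (root_mod_pchar pF t1_root) (root_mod_pchar pF t2_root).
have isoG := affine_group_isoGrp zP pF cardF p10 zt1 t12p.
pose map i ci := affine_map zP pF cardF p10 (i := i) ci.
have map_good (i : 'Z_10) ci : good (map i ci) /\ has_type (map i ci) 5 10.
  split; last exact: affine_map_type.
  split; [exact: cayley_regular | exact: affine_map_euler |].
  exact: isoGrp_trans (Aut_cayley_isog _ _ _) isoG.
exists (map _ coprime1), (map _ coprime3); split.
- exact: map_good.
- exact: map_good.
- exact: affine_map_noniso zt1.
- have classify := affine_map_classification zP pF cardF p10 zt1 t12p.
  move=> M [regM _ isoM] [type510|/type_dual type510].
    by have [] := classify M regM isoM type510; [left | right]; left.
  (* A map of type [{10, 5}] is the dual of one of type [{5, 10}]. *)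
  rewrite -Aut_dual in isoM.
  by have [] := classify _ (regular_dual regM) isoM type510; [left | right]; right.
by split; apply: affine_map_reflexive.
Qed.
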